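(* Let $\Upsilon_1=\{(1\text{-}2,0~1),(1\text{-}2,1~0),(2\text{-}1,1~0)\}$ and $\Upsilon_2=\{(1\text{-}2,0~1),(1\text{-}2,1~0),(2\text{-}1,1~0),(2\text{-}1,0~0)\}$. Then for all $n\ge1$ and $k\ge1$: (1) $Av_{n,k}^{\Upsilon_1}=\sum_{\substack{a_1+\cdots+a_k=n\\ a_i\ge0}}a_1!\,a_2!\cdots a_k!$; (2) $Av_{n,k}^{\Upsilon_2}=\binom{n+k-1}{k-1}$.
   Context: For integers $k\ge1$, $n\ge0$, $C_k\wr S_n$ denotes the set of pairs $(\sigma,w)$ where $\sigma=\sigma_1\cdots\sigma_n$ is a permutation of $\{1,\dots,n\}$ in one-line notation and $w=w_1\cdots w_n\in\{0,1,\dots,k-1\}^n$. For a pattern $(\tau,u)$ with $\tau\in S_2$ and $u\in\{00,01,10\}$ (e.g. $(2\text{-}1,1~0)$ means $\tau=21$, $u=10$), $(\tau,u)$ bi-occurs in $(\sigma,w)$ if there are $1\le i_1<i_2\le n$ (not necessarily adjacent) such that the relative order of $\sigma_{i_1},\sigma_{i_2}$ is that of $\tau$ and the relative order of $w_{i_1},w_{i_2}$ is that of $u$ (for $u=00$: $w_{i_1}=w_{i_2}$; $u=01$: $w_{i_1}<w_{i_2}$; $u=10$: $w_{i_1}>w_{i_2}$). $(\sigma,w)$ bi-avoids a set of patterns if no member bi-occurs in it; $Av_{n,k}^{\Upsilon}$ is the number of elements of $C_k\wr S_n$ bi-avoiding $\Upsilon$. *)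

(* Defs.v *)
From mathcomp Require Import all_boot all_fingroup.

Set Implicit Arguments.
Unset Strict Implicit.
Unset Printing Implicit Defensive.

(* C_k wr S_n as a set of pairs (sigma, w). Positions, values of sigma and
   values of tau are 0-based: 'I_n stands for {1, .., n}. *)
Notation colored_perm k n := ('S_n * n.-tuple 'I_k)%type.

(* A pattern (tau, u) of length 2. The word u is read up to order isomorphism,
   so 11 would be the same pattern as 00. *)
Notation pattern2 := ('S_2 * 2.-tuple 'I_2)%type.

Definition same_rel_order (a b c d : nat) : bool :=
  ((a < b) == (c < d)) && ((b < a) == (d < c)).

Definition bi_occurs (k n : nat) (p : pattern2) (x : colored_perm k n) : bool :=
  [exists i1 : 'I_n, exists i2 : 'I_n,
    [&& i1 < i2,
        same_rel_order (x.1 i1) (x.1 i2) (p.1 ord0) (p.1 ord_max)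
      & same_rel_order (tnth x.2 i1) (tnth x.2 i2)
                       (tnth p.2 ord0) (tnth p.2 ord_max)]].

Definition bi_avoids (k n : nat) (U : {set pattern2}) (x : colored_perm k n) :
  bool := [forall p in U, ~~ bi_occurs p x].

Definition Av (n k : nat) (U : {set pattern2}) : nat :=
  #|[set x : colored_perm k n | bi_avoids U x]|.

Definition perm12 : 'S_2 := 1%g.
Definition perm21 : 'S_2 := tperm ord0 ord_max.

Definition word00 : 2.-tuple 'I_2 := [tuple ord0; ord0].
Definition word01 : 2.-tuple 'I_2 := [tuple ord0; ord_max].
Definition word10 : 2.-tuple 'I_2 := [tuple ord_max; ord0].

Definition Upsilon1 : {set pattern2} :=
  [set (perm12, word01); (perm12, word10); (perm21, word10)].

Definition Upsilon2 : {set pattern2} :=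
  [set (perm12, word01); (perm12, word10); (perm21, word10); (perm21, word00)].

(* Main.v *)
(* A pair (s, w) avoids Upsilon1 iff w is weakly increasing and s reverses w:
   w_i < w_j forces s_j < s_i.  For a fixed f on positions, s reverses f iff
   f o s^-1 is the decreasing rearrangement of f, so the permutations reversing f
   form a coset of the stabilizer of f, whose size is the product of the
   factorials of the fibre sizes.  A sorted w is determined by its fibre sizes,
   which gives (1).  Avoiding Upsilon2 amounts to reversing an injective
   refinement of w, hence one s for each sorted w, and the sorted words number
   'C(n + k - 1, n). *)
Require Import Defs.
From mathcomp Require Import all_boot all_fingroup.

Set Implicit Arguments.
Unset Strict Implicit.
Unset Printing Implicit Defensive.

(** * Permutations preserving a map *)

Lemma card_perm_fibers (T I : finType) (f : T -> I) :
  #|[set p : {perm T} | [forall x, f (p x) == f x]]| =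
  \prod_i #|[set x | f x == i]|`!.
Proof.
set S := [set p | _]; pose fib i := [set x | f x == i].
(* [h] sends [p] to its restrictions to the fibres. It is inverted on families of permutations
   supported on the fibres by gluing: [x] goes to [g (f x) x]. *)
pose h (p : {perm T}) := [ffun i => restr_perm (fib i) p].
have SP (p : {perm T}) : reflect (forall x, f (p x) = f x) (p \in S).
  by rewrite inE; apply: (iffP forallP) => fp x; apply/eqP.
have fib_act (p : {perm T}) i : p \in S -> p \in 'N(fib i | 'P)%g.
  by move/SP=> fp; apply/astabsP => x; rewrite !inE /= apermE fp.
have hE (p : {perm T}) x : p \in S -> h p (f x) x = p x.
  by move=> Sp; rewrite ffunE restr_permE ?fib_act // inE.
have h_inj : {in S &, injective h}.
  by move=> p q Sp Sq e; apply/permP => x; rewrite -hE // e hE.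
rewrite -(card_in_imset h_inj).
transitivity #|family (fun i => perm_on (fib i))|.
  apply: eq_card => g; apply/imsetP/familyP => [[p Sp ->] i | gP].
    by rewrite ffunE; apply: restr_perm_on.
  have fg x : f (g (f x) x) = f x.
    have := perm_closed x (gP (f x)).
    by rewrite !inE eqxx => /eqP.
  have p_inj : injective (fun x => g (f x) x).
    by move=> x y e; move: (e); rewrite -(fg x) e fg; apply: perm_inj.
  have Sp : perm p_inj \in S by apply/SP => x; rewrite permE.
  exists (perm p_inj) => //; apply/ffunP => i; apply/permP => x.
  have [fx | nfx] := boolP (x \in fib i).
    by move: fx; rewrite inE => /eqP <-; rewrite hE // permE.
  by rewrite ffunE (out_perm (gP i) nfx) (out_perm (restr_perm_on _ _) nfx).
rewrite card_family foldrE big_map big_enum /=.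
by apply: eq_bigr => i _; rewrite card_perm.
Qed.

(** * Permutations reversing a map *)

Definition reverses (n : nat) (f : 'I_n -> nat) (s : 'S_n) : bool :=
  [forall i, forall j, (f i < f j) ==> (s j < s i)].

Lemma reversesP (n : nat) (f : 'I_n -> nat) (s : 'S_n) :
  reflect (forall i j, f i < f j -> s j < s i) (reverses f s).
Proof.
apply: (iffP forallP) => [H i j | H i].
  by move/forallP: (H i) => /(_ j)/implyP.
by apply/forallP => j; apply/implyP; apply: H.
Qed.

(* Both words are the decreasing rearrangement of the values of [f]. *)
Lemma reverses_inv (n : nat) (f : 'I_n -> nat) (s t : 'S_n) :
  reverses f s -> reverses f t -> forall y, f (s^-1%g y) = f (t^-1%g y).
Proof.
pose W (u : 'S_n) := [seq f (u^-1%g y) | y <- enum 'I_n].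
have sortedW u : reverses f u -> sorted geq (W u).
  move/reversesP => H; rewrite sorted_map.
  have : sorted ltn (map val (enum 'I_n)) by rewrite val_enum_ord iota_ltn_sorted.
  rewrite sorted_map; apply: sub_sorted => y z /= yz.
  by rewrite /= leqNgt; apply/negP => /H; rewrite !permKV ltnNge (ltnW yz).
have permW u : perm_eq (W u) [seq f y | y <- enum 'I_n].
  rewrite /W (map_comp f); apply: perm_map; apply: uniq_perm.
  - by rewrite (map_inj_uniq perm_inj) enum_uniq.
  - exact: enum_uniq.
  move=> x; rewrite mem_enum; apply/mapP; exists (u x); rewrite ?mem_enum //.
  by rewrite permK.
move=> rs rt y.
have eqW : W s = W t.
  apply: (sorted_eq _ _ (sortedW s rs) (sortedW t rt)).
  - by move=> a b c /= ba ac; apply: leq_trans ac ba.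
  - by move=> a b /=; rewrite andbC -eqn_leq => /eqP.
  - by rewrite (perm_trans (permW s)) // perm_sym.
by move/eq_in_map: eqW; apply; rewrite mem_enum.
Qed.

(** Right multiplication by [t] carries the stabilizer of [f] onto the reversing permutations; by
    [reverses_inv], [s * t^-1] preserves [f] when [s] reverses it. *)
Lemma card_reverses (n : nat) (f : 'I_n -> nat) (t : 'S_n) :
  reverses f t ->
  #|[set s | reverses f s]| = #|[set p : 'S_n | [forall x, f (p x) == f x]]|.
Proof.
move=> rt; rewrite -[RHS](card_imset _ (@mulIg _ t)); apply: eq_card => s.
apply/idP/imsetP => [| [p]]; rewrite !inE.
  move=> rs; exists (s * t^-1)%g; last by rewrite mulgKV.
  rewrite inE; apply/forallP => x; rewrite permM.
  by rewrite -(reverses_inv rs rt) permK.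
move=> /forallP H ->; apply/reversesP => i j fij; rewrite !permM.
by move/reversesP: rt; apply; rewrite (eqP (H i)) (eqP (H j)).
Qed.

(** Existence: send [i] to its rank, the number of [j] with [f i < f j]. Uniqueness: [reverses_inv]
    determines [f] composed with the inverse, and [f] cancels. *)
Lemma card_reverses_inj (n : nat) (f : 'I_n -> nat) :
  injective f -> #|[set s | reverses f s]| = 1.
Proof.
move=> f_inj.
pose D i := [set j | f i < f j].
have ltD i : #|D i| < n.
  rewrite -[X in _ < X]card_ord -cardsT; apply: proper_card.
  by apply/properP; split; [apply: subsetT | exists i; rewrite ?inE ?ltnn].
have lt_rank i j : f i < f j -> #|D j| < #|D i|.
  move=> fij; apply: proper_card; apply/properP; split.
    by apply/subsetP => x; rewrite !inE; apply: ltn_trans.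
  by exists j; rewrite !inE ?ltnn.
have rank_inj : injective (fun i => Ordinal (ltD i)).
  move=> i j /(congr1 val) /= e; apply: f_inj.
  by case: (ltngtP (f i) (f j)) => // /lt_rank; rewrite e ltnn.
have rt : reverses f (perm rank_inj).
  by apply/reversesP => i j /lt_rank; rewrite !permE.
apply/eqP/cards1P; exists (perm rank_inj); apply/setP => s.
rewrite !inE; apply/idP/eqP => [rs | -> //].
by apply: invg_inj; apply/permP => y; apply: f_inj; apply: reverses_inv.
Qed.

(** * Sorted words and their letter counts *)

Lemma sorted_tupleP (n k : nat) (w : n.-tuple 'I_k) :
  reflect (forall i j : 'I_n, i < j -> tnth w i <= tnth w j)
          (sorted leq (map val w)).
Proof.
rewrite (sorted_pairwise leq_trans).
have nthE (i : 'I_n) : nth 0 (map val w) i = tnth w i.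
  by rewrite -(tnth_nth 0 (map_tuple val w)) tnth_map.
apply: (iffP (pairwiseP 0)) => [H i j ij | H i j].
  by rewrite -!nthE; apply: H; rewrite // inE size_map size_tuple.
rewrite !inE size_map size_tuple => lt_i lt_j ij.
by rewrite (nthE (Ordinal lt_i)) (nthE (Ordinal lt_j)); apply: H.
Qed.

Lemma card_tnth_eq (n k : nat) (w : n.-tuple 'I_k) (c : 'I_k) :
  #|[set j | tnth w j == c]| = count_mem c w.
Proof. by rewrite -sum1_count big_tuple -sum1dep_card. Qed.

Lemma sum_sorted_tuple_counts (n k : nat) (F : 'I_k -> nat -> nat) :
  \sum_(w : n.-tuple 'I_k | sorted leq (map val w)) \prod_c F c (count_mem c w) =
  \sum_(a : {ffun 'I_k -> 'I_n.+1} | \sum_(i < k) a i == n) \prod_i F i (a i).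
Proof.
pose h (w : n.-tuple 'I_k) : {ffun 'I_k -> 'I_n.+1} :=
  [ffun c => inord (count_mem c w)].
(* Each count is at most [n], so [inord] loses nothing. *)
have hE w c : h w c = count_mem c w :> nat.
  by rewrite ffunE inordK // ltnS -[n in _ <= n](size_tuple w) count_size.
pose leI (i j : 'I_k) := i <= j.
have leI_tr : transitive leI by move=> a b c; apply: leq_trans.
have leI_anti : antisymmetric leI by move=> a b; rewrite -eqn_leq => /eqP/val_inj.
pose A := [set w : n.-tuple 'I_k | sorted leI w].
have h_inj : {in A &, injective h}.
  move=> w v; rewrite !inE => sw sv e; apply: val_inj.
  apply: (sorted_eq leI_tr leI_anti sw sv).
  by apply/allP => c _ /=; rewrite -!hE e.
rewrite [RHS](eq_bigl (mem (h @: A))).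
  rewrite big_imset //=; apply: eq_big => [w | w _].
    by rewrite inE sorted_map.
  by apply: eq_bigr => c _; rewrite hE.
move=> a; apply/eqP/imsetP => [sum_a | [w _ ->]].
  (* The word with counts [a] is made of [a c] copies of each [c]; applying [sort] gives sortedness
     at once and keeps the counts. *)
  pose s := sort leI (flatten [seq nseq (a c) c | c <- enum 'I_k]).
  have size_s : size s == n.
    rewrite size_sort size_flatten /shape -map_comp sumnE big_map big_enum /=.
    by rewrite -[X in _ == X]sum_a; apply/eqP/eq_bigr => c _; rewrite size_nseq.
  exists (Tuple size_s).
    by rewrite inE; apply: sort_sorted => i j; apply: leq_total.
  apply/ffunP => c; apply: ord_inj; rewrite hE /= count_sort count_flatten.
  rewrite -map_comp sumnE big_map big_enum /= (bigD1 c) //=.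
  rewrite count_nseq /= eqxx mul1n.
  by rewrite big1 ?addn0 // => d dc; rewrite count_nseq /= (negPf dc).
under eq_bigr do rewrite hE -sum1_count.
rewrite (exchange_big_dep xpredT) //=.
rewrite -[RHS](size_tuple w) -sum1_size; apply: eq_bigr => c _.
by apply: big_pred1 => d; rewrite /= eq_sym.
Qed.

(** * Avoidance in terms of sorted words and reversal *)

Lemma bi_avoids_set1 (k n : nat) (p : pattern2) (x : colored_perm k n) :
  bi_avoids [set p] x = ~~ bi_occurs p x.
Proof.
apply/forallP/idP => [/(_ p)|H q]; first by rewrite set11.
by apply/implyP; rewrite inE => /eqP ->.
Qed.

Lemma bi_avoidsU (k n : nat) (U V : {set pattern2}) (x : colored_perm k n) :
  bi_avoids (U :|: V) x = bi_avoids U x && bi_avoids V x.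
Proof.
apply/forall_inP/andP => [H | [/forall_inP HU /forall_inP HV] p].
  by split; apply/forall_inP => p Up; apply: H; rewrite inE Up ?orbT.
by rewrite inE => /orP [/HU | /HV].
Qed.

Lemma bi_avoidsP (k n : nat) (p : pattern2) (x : colored_perm k n) :
  reflect (forall i j : 'I_n, i < j ->
             same_rel_order (x.1 i) (x.1 j) (p.1 ord0) (p.1 ord_max) ->
             same_rel_order (tnth x.2 i) (tnth x.2 j)
                            (tnth p.2 ord0) (tnth p.2 ord_max) -> False)
          (~~ bi_occurs p x).
Proof.
apply: (iffP idP) => [/existsP H i j ij so wo | H].
  by apply: H; exists i; apply/existsP; exists j; rewrite ij so wo.
apply/existsP => -[i /existsP [j /and3P [ij so wo]]]; exact: (H i j).
Qed.

Lemma same_rel_order01 a b : same_rel_order a b 0 1 = (a < b).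
Proof. by rewrite /same_rel_order; case: ltngtP. Qed.

Lemma same_rel_order10 a b : same_rel_order a b 1 0 = (b < a).
Proof. by rewrite /same_rel_order; case: ltngtP. Qed.

Lemma same_rel_order00 a b : same_rel_order a b 0 0 = (a == b).
Proof. by rewrite /same_rel_order; case: ltngtP. Qed.

Definition same_rel_orderE :=
  (same_rel_order01, same_rel_order10, same_rel_order00).

Lemma perm_ltn_total (n : nat) (s : 'S_n) (i j : 'I_n) :
  i < j -> (s i < s j) || (s j < s i).
Proof.
move=> ij; rewrite -neq_ltn; apply/eqP => /val_inj/perm_inj e.
by rewrite e ltnn in ij.
Qed.

(** A descent of [w] yields (12, 10) or (21, 10), depending on how [s] orders the two positions, so
    [w] is sorted. Then smaller colours come first, and avoiding (12, 01) makes [s] decrease between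
    different colours. *)
Lemma bi_avoids_Upsilon1 (k n : nat) (s : 'S_n) (w : n.-tuple 'I_k) :
  bi_avoids Upsilon1 (s, w) =
  sorted leq (map val w) && reverses (fun i => tnth w i) s.
Proof.
rewrite !bi_avoidsU !bi_avoids_set1.
apply/idP/andP.
  case/andP => /andP [/bi_avoidsP /= A /bi_avoidsP /= B] /bi_avoidsP /= C.
  move: A B C; rewrite !perm1 tpermL tpermR => A B C.
  have srt (i j : 'I_n) : i < j -> tnth w i <= tnth w j.
    move=> ij; rewrite leqNgt; apply/negP => wji.
    case/orP: (perm_ltn_total s ij) => sij.
      by apply: (B i j ij); rewrite ?same_rel_orderE.
    by apply: (C i j ij); rewrite ?same_rel_orderE.
  split; first exact/sorted_tupleP.
  apply/reversesP => i j wij.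
  have ij : i < j.
    case: (ltngtP i j) => // [ji | /val_inj e].
      by have := srt _ _ ji; rewrite leqNgt wij.
    by rewrite e ltnn in wij.
  case/orP: (perm_ltn_total s ij) => // sij.
  by case: (A i j ij); rewrite ?same_rel_orderE.
case=> /sorted_tupleP srt /reversesP rev.
apply/andP; split; [apply/andP; split|]; apply/bi_avoidsP => i j ij /=;
  rewrite ?perm1 ?tpermL ?tpermR !same_rel_orderE => sij wij.
- by have := rev _ _ wij; rewrite ltnNge (ltnW sij).
- by have := srt _ _ ij; rewrite leqNgt wij.
- by have := srt _ _ ij; rewrite leqNgt wij.
Qed.

(* Ties between equal colours are broken by decreasing position, so a
   permutation that reverses the key is increasing on each colour class. *)
Definition key (n k : nat) (w : n.-tuple 'I_k) (i : 'I_n) : nat :=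
  tnth w i * n + rev_ord i.

Lemma ltn_key (n k : nat) (w : n.-tuple 'I_k) (i j : 'I_n) :
  (key w i < key w j) =
  (tnth w i < tnth w j) || (tnth w i == tnth w j) && (j < i).
Proof.
have lt_key (a b : 'I_n) : tnth w a < tnth w b -> key w a < key w b.
  move=> wab; apply: leq_trans (leq_addr _ _).
  (* A colour gap contributes at least [n] to the key, more than any value of [rev_ord]; hence the
     key order is lexicographic. *)
  rewrite -ltn_subRL -mulnBl; apply: leq_trans (ltn_ord (rev_ord a)) _.
  by rewrite leq_pmull // subn_gt0.
rewrite -val_eqE; case: (ltngtP (tnth w i) (tnth w j)) => /= [/lt_key // | /lt_key | e].
  by move=> lt_ji; apply/negbTE; rewrite -leqNgt ltnW.
by rewrite /key e ltn_add2l /= ltn_sub2lE.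
Qed.

Lemma key_inj (n k : nat) (w : n.-tuple 'I_k) : injective (key w).
Proof.
move=> i j e; apply: val_inj.
have := ltn_key w i j; have := ltn_key w j i; rewrite e ltnn -!val_eqE.
by case: (ltngtP (tnth w i) (tnth w j)) => //= _; case: ltngtP.
Qed.

(** Reversing [key w] splits by colour: on unequal colours it is reversing [w], on equal colours it
    is avoiding (21, 00). *)
Lemma bi_avoids_Upsilon2 (k n : nat) (s : 'S_n) (w : n.-tuple 'I_k) :
  bi_avoids Upsilon2 (s, w) = sorted leq (map val w) && reverses (key w) s.
Proof.
have -> : Upsilon2 = Upsilon1 :|: [set (perm21, word00)] by [].
rewrite bi_avoidsU bi_avoids_Upsilon1 bi_avoids_set1 -andbA; congr (_ && _).
apply/andP/reversesP => [[/reversesP rev /bi_avoidsP /=] | rev].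
  rewrite tpermL tpermR => D i j; rewrite ltn_key => /orP [/rev // |].
  case/andP => /eqP wij ji; case/orP: (perm_ltn_total s ji) => // sij.
  by case: (D j i ji); rewrite ?same_rel_orderE ?wij.
split; first by apply/reversesP => i j wij; apply: rev; rewrite ltn_key wij.
apply/bi_avoidsP => i j ij /=; rewrite tpermL tpermR !same_rel_orderE => sij wij.
have : s i < s j by apply: rev; rewrite ltn_key -val_eqE eq_sym wij ij orbT.
by rewrite ltnNge (ltnW sij).
Qed.

(** * Counting word by word *)

Lemma Av_sum (n k : nat) (U : {set pattern2}) (S : pred (n.-tuple 'I_k))
    (Q : n.-tuple 'I_k -> pred 'S_n) :
  (forall s w, @bi_avoids k n U (s, w) = S w && Q w s) ->
  Av n k U = \sum_(w | S w) #|[set s | Q w s]|.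
Proof.
move=> UE; rewrite /Av -sum1dep_card.
rewrite (eq_bigl (fun x : colored_perm k n => S x.2 && Q x.2 x.1)); last first.
  by case=> s w; rewrite UE.
under [RHS]eq_bigr do rewrite -sum1dep_card.
rewrite pair_big_dep /=.
rewrite (reindex (fun x : n.-tuple 'I_k * 'S_n => (x.2, x.1))) //=.
by exists (fun x => (x.2, x.1)) => -[].
Qed.

(* The parts a_i are bounded by n, as the constraint on their sum forces. *)
Theorem theorem7 (n k : nat) (hn : 1 <= n) (hk : 1 <= k) :
  Av n k Upsilon1 =
    \sum_(a : {ffun 'I_k -> 'I_n.+1} | \sum_(i < k) a i == n)
      \prod_(i < k) (a i)`!
  /\ Av n k Upsilon2 = 'C(n + k - 1, k - 1).
Proof.
split.
  rewrite (Av_sum (@bi_avoids_Upsilon1 k n)).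
  rewrite -(sum_sorted_tuple_counts _ (fun _ => factorial)).
  apply: eq_bigr => w /sorted_tupleP srt.
  (* The order-reversing permutation of the positions reverses every sorted word, so it can
     represent the coset. *)
  rewrite (@card_reverses _ _ (perm rev_ord_inj)); last first.
    apply/reversesP => i j wij; rewrite !permE /= ltn_sub2lE //.
    rewrite ltnS; case: (ltngtP i j) wij => // [/srt | /val_inj ->].
      by rewrite leqNgt => /negPf ->.
    by rewrite ltnn.
  transitivity (\prod_c #|[set j | tnth w j == c]|`!).
    by rewrite -card_perm_fibers; apply: eq_card => p; rewrite !inE.
  by apply: eq_bigr => c _; rewrite card_tnth_eq.
rewrite (Av_sum (@bi_avoids_Upsilon2 k n)).
under eq_bigr => w _ do rewrite (card_reverses_inj (@key_inj n k w)).
(* [card_sorted_tuples] needs an alphabet of successor size and gives ['C(n + k, n)] for the new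
   [k]; symmetry of binomials finishes. *)
case: k hk => // k _.
by rewrite sum1dep_card card_sorted_tuples addnS !subn1 /= -bin_sub ?leq_addr // addKn.
Qed.
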